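(* Assume the continuum hypothesis $2^{\aleph_0}=\aleph_1$. Let $(X,\mathcal{C})$ be a category base which is point-meager, is a Baire base, and satisfies the countable chain condition. Let $\Phi$ be a set of one-to-one mappings of $X$ onto $X$ which is closed under composition of mappings and formation of inverses, and suppose that $\Phi$ has cardinality at most $2^{\aleph_0}$. Suppose moreover that $\mathcal{C}$ is $\Phi$-invariant, that $\mathcal{C}$ has cardinality at most $2^{\aleph_0}$, and that for any two regions $C$ and $D$ there exists $\phi\in\Phi$ such that $C\cap\phi(D)$ contains a region. Then for every abundant Baire set $E\subseteq X$ satisfying $\phi(E)=E$ for all $\phi\in\Phi$, there exists a family $\{A_i : i\in I\}$ of subsets of $E$, of cardinality $2^{\aleph_1}$, such that: (1) each $A_i$ is a rare set and is not a Baire set; (2) for every $i\in I$ and every $\phi\in\Phi$, $\phi(A_i)$ is also a rare set; (3) the family $\{A_i : i\in I\}$ is strictly $\aleph_0$-independent, and hence $\aleph_0$-independent, in $E$ with respect to $(X,\mathcal{C})$.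
   Context: **Category base.** A pair $(X,\mathcal{C})$, where $X$ is a non-empty set and $\mathcal{C}$ is a family of subsets of $X$, is a category base if the non-empty members of $\mathcal{C}$, called regions, satisfy the following axioms. (1) Every point of $X$ belongs to some region, i.e. $X=\bigcup\mathcal{C}$. (2) Let $A$ be a region and let $\mathcal{D}$ be any non-empty family of (pairwise) disjoint regions having cardinality less than the cardinality of $\mathcal{C}$. (i) If $A\cap(\bigcup\mathcal{D})$ contains a region, then there exists a region $D\in\mathcal{D}$ such that $A\cap D$ contains a region. (ii) If $A\cap(\bigcup\mathcal{D})$ contains no region, then there exists a region $B\subseteq A$ which is disjoint from every region in $\mathcal{D}$. **Types of sets.** Let $(X,\mathcal{C})$ be a category base; a subregion of a region is a region contained in it. - A set $S\subseteq X$ is singular if every region contains a subregion which is disjoint from $S$. - A set is meager if it is a countable union of singular sets; otherwise it is abundant. - A set $S$ is a Baire set if every region contains a subregion $D$ such that $D\cap S$ is meager or $D\cap(X\setminus S)$ is meager. A non-Baire set is a set that is not a Baire set. - A set is a rare set if its intersection with every meager set is countable (countable means of cardinality at most $\aleph_0$). **Types of bases.** $(X,\mathcal{C})$ is point-meager if every singleton is meager. It is a Baire base if every region is abundant. It satisfies the countable chain condition if every family of pairwise disjoint regions is countable. **Invariance.** For a family $\mathcal{S}$ of subsets of $X$ and $\phi\in\Phi$, put $\phi(\mathcal{S})=\{\phi(S):S\in\mathcal{S}\}$. The family $\mathcal{S}$ is $\Phi$-invariant if $\phi(\mathcal{S})=\mathcal{S}$ for all $\phi\in\Phi$. **Full subset.**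 A set $F$ is a full subset of a set $E$ if $F\subseteq E$ and, for every abundant Baire set $B$, $B\cap F$ is abundant whenever $B\cap E$ is abundant. **Independence.** A family $\{A_i:i\in I\}$ of subsets of an abundant set $E$ is $\aleph_0$-independent (resp. strictly $\aleph_0$-independent) in $E$ with respect to $(X,\mathcal{C})$ if for each $J\subseteq I$ with $\mathrm{card}(J)<\aleph_0$ (resp. $\mathrm{card}(J)\le\aleph_0$) and every function $f:J\to\{0,1\}$, the set $\bigcap_{j\in J}A_j^{f(j)}$ is a full subset of $E$, where $A_j^{0}=A_j$ and $A_j^{1}=E\setminus A_j$ (the empty intersection being $E$). *)

(* Defs.v *)
From mathcomp Require Import all_boot.
From mathcomp Require Import all_classical.

Set Implicit Arguments.
Unset Strict Implicit.
Unset Printing Implicit Defensive.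

Local Open Scope classical_set_scope.
Local Open Scope card_scope.

(** * Cardinals *)

Definition card_lt (T U : Type) (A : set T) (B : set U) : Prop :=
  A #<= B /\ ~ (B #<= A).

(* aleph_1 is the least uncountable cardinal; every cardinal below [A] is the
   cardinal of some subset of [A], so only subsets need to be considered. *)
Definition has_card_aleph1 (T : Type) (A : set T) : Prop :=
  ~ countable A /\
  forall B : set T, B `<=` A -> card_lt B A -> countable B.

(* The continuum 2^aleph_0 is represented by the power set of [nat]. *)
Definition continuum_hypothesis : Prop := has_card_aleph1 [set: set nat].

Definition has_card_two_pow_aleph1 (T : Type) (A : set T) : Prop :=
  exists W : Type, has_card_aleph1 [set: W] /\ A #= [set: set W].

(** * Category bases *)

Section CategoryBase.
Variables (X : Type) (C : set (set X)).

Definition region (A : set X) : Prop := C A /\ A !=set0.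

Definition contains_region (S : set X) : Prop :=
  exists2 R, region R & R `<=` S.

Definition disjoint_regions (D : set (set X)) : Prop :=
  D `<=` region /\ trivIset D id.

Record category_base : Prop := CategoryBase {
  category_base_nonempty : [set: X] !=set0 ;
  category_base_cover : \bigcup_(A in C) A = [set: X] ;
  category_base_meet : forall (A : set X) (D : set (set X)),
    region A -> D !=set0 -> disjoint_regions D -> card_lt D C ->
    contains_region (A `&` \bigcup_(B in D) B) ->
    exists2 B, D B & contains_region (A `&` B) ;
  category_base_avoid : forall (A : set X) (D : set (set X)),
    region A -> D !=set0 -> disjoint_regions D -> card_lt D C ->
    ~ contains_region (A `&` \bigcup_(B in D) B) ->
    exists B, [/\ region B, B `<=` A & forall R, D R -> B `&` R = set0]
}.

Definition singular (S : set X) : Prop :=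
  forall A, region A -> exists B, [/\ region B, B `<=` A & B `&` S = set0].

(* The empty set is singular, so sequences cover all countable unions. *)
Definition meager (S : set X) : Prop :=
  exists F : nat -> set X, (forall n, singular (F n)) /\ S = \bigcup_n F n.

Definition abundant (S : set X) : Prop := ~ meager S.

Definition Baire_set (S : set X) : Prop :=
  forall A, region A ->
    exists B, [/\ region B, B `<=` A & meager (B `&` S) \/ meager (B `&` ~` S)].

Definition rare (S : set X) : Prop :=
  forall M, meager M -> countable (S `&` M).

Definition point_meager : Prop := forall x : X, meager [set x].

Definition Baire_base : Prop := forall A, region A -> abundant A.

Definition countable_chain_condition : Prop :=
  forall D : set (set X), disjoint_regions D -> countable D.

Definition full_subset (F E : set X) : Prop :=
  F `<=` E /\
  forall B, abundant B -> Baire_set B ->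
    abundant (B `&` E) -> abundant (B `&` F).

(* The set called A_i^0 (resp. A_i^1) is obtained for [b = false]
   (resp. [b = true]). *)
Definition signed (E : set X) (b : bool) (A : set X) : set X :=
  if b then E `\` A else A.

(* For subsets [A i] of [E], intersecting with [E] only matters when [J] is
   empty: it makes the empty intersection equal to [E].  Only the values of
   [f] on [J] are used. *)
Definition signed_bigcap (E : set X) (I : Type) (A : I -> set X)
    (J : set I) (f : I -> bool) : set X :=
  E `&` \bigcap_(j in J) signed E (f j) (A j).

Definition aleph0_independent (E : set X) (I : Type) (A : I -> set X) : Prop :=
  forall (J : set I) (f : I -> bool),
    finite_set J -> full_subset (signed_bigcap E A J f) E.

Definition strictly_aleph0_independent
    (E : set X) (I : Type) (A : I -> set X) : Prop :=
  forall (J : set I) (f : I -> bool),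
    countable J -> full_subset (signed_bigcap E A J f) E.

End CategoryBase.

(** * Groups of bijections *)

Record bijection_group (X : Type) (Phi : set (X -> X)) : Prop :=
  BijectionGroup {
    bijection_group_bij : forall phi, Phi phi -> bijective phi ;
    bijection_group_comp : forall phi psi,
      Phi phi -> Phi psi -> Phi (phi \o psi) ;
    bijection_group_inv : forall phi psi,
      Phi phi -> cancel phi psi -> cancel psi phi -> Phi psi
  }.

Definition family_invariant (X : Type) (Phi : set (X -> X))
    (S : set (set X)) : Prop :=
  forall phi, Phi phi -> [set phi @` A | A in S] = S.

(* Main.v *)
Require Import Defs.
From Stdlib Require Import Inverse_Image.
From mathcomp Require Import all_boot.
From mathcomp Require Import all_classical wochoice.

Set Implicit Arguments.
Unset Strict Implicit.
Unset Printing Implicit Defensive.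

Local Open Scope classical_set_scope.
Local Open Scope card_scope.

(** The sets [A i] are pieces of one Luzin set.  By the countable chain
    condition a singular set misses a countable union of regions whose
    complement is still singular ([countable_predense]); as there are at most
    continuum many regions, the meager sets have a cofinal family [N] indexed
    by [set nat] ([meager_cofinal_continuum]).  Under the continuum hypothesis
    [set nat] also carries a well-order of type omega_1
    ([omega1_well_order]), so points [x a] of [E] can be chosen by recursion,
    pairwise distinct, with [x a] in a prescribed region and outside every
    [N b] for [b] up to [a]: at each stage only a meager set is forbidden.
    A meager set lies in some [N b], hence contains [x a] for countably many
    [a] only, so every subset of the range of [x] is rare; conversely a set
    containing [x a] for uncountably many [a] is abundant
    ([Luzin_enumeration]).

    Fullness can be tested on regions: an abundant Baire set contains a region
    up to a meager set ([abundant_Baire_region]), the category-base form of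
    the Banach category theorem.  It is therefore enough to give every point
    [x a] a label [slice a 0] in such a way that each pair (label, region)
    serves for uncountably many [a], and to let [A Y] consist of the points
    whose label belongs to [independent_codes Y].  These label sets are a
    Fichtenholz-Kantorovich-Hausdorff family: its members are indexed by all
    [Y : set (set nat)], and any countably many of them, each one complemented
    or not, have a common element ([independent_codesP]).

    Independence then yields the rest.  Distinct [Y] and [Z] give distinct
    sets, as [A Y] minus [A Z] is abundant; and were [A Y] Baire, it would be
    an abundant Baire set disjoint from the full set [E `\` A Y].  The maps in
    [Phi] permute the regions, so they preserve meager sets and rare sets. *)

(** * Countability and transfinite choice *)

Lemma card_le_range (T U : Type) (A : set T) (B : set U) :
  A !=set0 -> A #<= B -> exists u : U -> T, A = u @` B.
Proof.
move=> /set0P A0 /pfcard_geP [AE|[u]]; first by rewrite AE eqxx in A0.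
by apply/surjfunPex; split.
Qed.

Lemma countable_range (T : Type) (A : set T) :
  A !=set0 -> countable A -> exists u : nat -> T, A = range u.
Proof. exact: card_le_range. Qed.

Lemma countableU (T : Type) (A B : set T) :
  countable A -> countable B -> countable (A `|` B).
Proof.
move=> cA cB; have -> : A `|` B = \bigcup_(b : bool) (if b then A else B).
  apply/seteqP; split=> [x [?|?]|x [[] _ ?]]; [by exists true|by exists false|by left|by right].
by apply: bigcup_countable => // -[].
Qed.

Lemma countable_image (T U : Type) (f : T -> U) (A : set T) :
  countable A -> countable (f @` A).
Proof. exact/card_le_trans/card_image_le. Qed.

(** A set of cardinality aleph_1 has a well-order of type omega_1: in an
    arbitrary well-order, either all initial segments are countable, or the
    least uncountable one has the cardinality of the whole set while its own
    initial segments are countable. *)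
Lemma omega1_well_order (W : Type) : has_card_aleph1 [set: W] ->
  exists lt : W -> W -> Prop,
    [/\ well_founded lt, forall a b, [\/ lt a b, a = b | lt b a]
      & forall a, countable [set b | lt b a]].
Proof.
elim/Ppointed: W => W [ncW minW].
  by exfalso; apply: ncW; rewrite emptyE.
have [R woR] := well_ordering_principle W.
have antiR : antisymmetric R.
  move=> a b; apply: (@wo_chain_antisymmetric W R predT) => //.
  by move=> A _; exact: woR.
pose lt a b := R a b /\ a <> b.
have minR (P : set W) : P !=set0 -> exists z, P z /\ forall x, P x -> R z x.
  move=> [x Px]; have [|z [[zP zmin] _]] := woR (mem P); first by exists x; apply/mem_set.
  by exists z; split; [exact/set_mem | move=> y Py; exact/zmin/mem_set].
have wf : well_founded lt.
  move=> a; apply: contrapT => /(ex_intro (fun x => ~ Acc lt x) a) /minR [z [nz zmin]].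
  apply: nz; constructor => y [Ryz yz]; apply: contrapT => /zmin Rzy.
  by apply: yz; apply: antiR; rewrite Ryz.
have tot a b : [\/ lt a b, a = b | lt b a].
  have [->|ab] := pselect (a = b); first exact: Or32.
  have [z [[->|->] zmin]] := minR [set a; b] (ex_intro _ a (or_introl erefl)).
    by apply: Or31; split=> //; apply: zmin; right.
  by apply: Or33; split; [apply: zmin; left | exact/nesym].
(* An injection [g] with values in the points with countable initial segment
   pulls the order back to one of type omega_1. *)
have [g [ginj gc]] :
    exists g : W -> W, injective g /\ forall a, countable [set b | lt b (g a)].
  have [allc|] := pselect (forall a, countable [set b | lt b a]).
    by exists id; split=> // a b.
  move/existsNP/minR => [z [zunc zmin]].
  have segc a : lt a z -> countable [set b | lt b a].
    move=> [Raz az]; apply: contrapT => /zmin Rza.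
    by apply: az; apply: antiR; rewrite Raz.
  have : [set: W] #<= [set b | lt b z].
    apply: contrapT => nle; apply: zunc; apply: minW => //.
    by split=> //; exact: subset_card_le.
  move=> /pcard_leP/injfunPex [g gz ginj]; exists g; split=> [a b|a].
    by apply: ginj; rewrite inE.
  by apply: segc; exact: gz.
exists (fun a b => lt (g a) (g b)); split.
- exact: wf_inverse_image.
- move=> a b; have [?|/ginj|?] := tot (g a) (g b); [exact: Or31|exact: Or32|exact: Or33].
- move=> a; apply: sub_countable (gc a).
  rewrite -(card_le_eql (inj_card_eq (in2W ginj))); apply: subset_card_le.
  by move=> _ [b /= ? <-].
Qed.

(** At stage [a] only the countably many values taken earlier are forbidden, so
    the recursion never gets stuck; totality of the order makes the result
    injective. *)
Lemma transfinite_injective_choice (W X : Type) (lt : W -> W -> Prop)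
    (T : W -> set X) :
  well_founded lt -> (forall a b, [\/ lt a b, a = b | lt b a]) ->
  (forall a, countable [set b | lt b a]) ->
  (forall a (D : set X), countable D -> (T a `\` D) !=set0) ->
  exists x : W -> X, injective x /\ forall a, T a (x a).
Proof.
move=> wf tot segc room.
have [|pick pickP] := @choice (W * set X) X
    (fun aD y => countable aD.2 -> (T aD.1 `\` aD.2) y).
  move=> [a D] /=; have [cD|ncD] := pselect (countable D).
    by have [y ?] := room a D cD; exists y.
  (* Any value will do here; emptying the forbidden set yields one. *)
  by have [y ?] := room a _ (countable0 X); exists y.
pose prev a (rec : forall b, lt b a -> X) := [set y | exists b h, y = rec b h].
pose x := Fix wf (fun _ => X) (fun a rec => pick (a, prev a rec)).
have xE a : x a = pick (a, x @` [set b | lt b a]).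
  rewrite /x Fix_eq => [|b f g fg].
    congr (pick (_, _)); apply/seteqP; split=> [_ [b [h ->]]|_ [b h <-]].
      by exists b.
    by exists b, h.
  by congr pick; congr (_, prev _ _); apply/functional_extensionality_dep => c; apply/funext.
have xP a : (T a `\` (x @` [set b | lt b a])) (x a).
  by rewrite xE; apply: (pickP (a, _)); exact/countable_image.
exists x; split=> [a b xab|a]; last by have [] := xP a.
have [ab|//|ba] := tot a b; exfalso.
  by have [_] := xP b; apply; exists a.
by have [_] := xP a; apply; exists b.
Qed.

(** * Coding by subsets of nat *)

(** A subset of [nat], cut into slices, codes an arbitrary sequence of subsets
    of [nat]; countably many choices among continuum many objects thus become
    one element of [set nat]. *)
Definition slice (r : set nat) (n : nat) : set nat := [set m | r (pickle (n, m))].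

Lemma slice_surjective (u : nat -> set nat) : exists r, forall n, slice r n = u n.
Proof.
exists [set k | exists n m, k = pickle (n, m) /\ u n m] => n.
apply/seteqP; split=> [m [n' [m' [/(pcan_inj pickleK) [-> ->]]]]//|m unm].
by exists n, m.
Qed.

Definition trace (F : nat -> set nat) (Y : set (set nat)) : set nat :=
  [set k | Y (F k)].

(** The independent family on the set of pairs ([F], [P]), where [F] enumerates
    a countable set of points of [set nat] and [P] is a countable set of traces
    on [F]: the pair belongs to the member [Y] when the trace of [Y] lies in
    [P].  Slice 1 of a code gives [F], and [P] is the set of those entries of
    slice 2 whose index lies in slice 0; selecting the indices by a set allows
    [P] to be empty. *)
Definition independent_codes (Y : set (set nat)) : set (set nat) :=
  [set r | exists2 n, slice r 0 n &
     trace (slice (slice r 1)) Y = slice (slice r 2) n].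

Lemma countable_separating_trace (Y : nat -> set (set nat)) :
  exists F, forall m n, trace F (Y m) = trace F (Y n) -> Y m = Y n.
Proof.
have [|z zP] := @choice (nat * nat) (set nat)
    (fun k z => Y k.1 z = Y k.2 z -> Y k.1 = Y k.2).
  move=> [m n] /=; have [?|] := pselect (Y m = Y n); first by exists set0.
  move=> mn; apply: contrapT => /forallNP nz; apply: mn; apply/funext => z.
  by apply: contrapT => nYz; apply: (nz z) => /nYz.
exists (fun k => z (odflt (0, 0) (unpickle k))) => m n tmn.
by apply: (zP (m, n)); have := congr1 (@^~ (pickle (m, n))) tmn; rewrite /trace /= pickleK.
Qed.

(** Let [F] separate the countably many members of [J] and let [P] be the set of
    traces of those [Y] with [f Y = false]: the trace on [F] determines a member
    of [J], hence its sign. *)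
Lemma independent_codesP (J : set (set (set nat))) (f : set (set nat) -> bool) :
  countable J -> exists r, forall Y, J Y -> independent_codes Y r <-> f Y = false.
Proof.
move=> cJ.
(* A dummy member makes the set to be enumerated non-empty. *)
have [||Y JY] := @countable_range _ (J `|` [set set0]); first by exists set0; right.
  exact: countableU.
have [F sepF] := countable_separating_trace Y.
have [cF /funext cFE] := slice_surjective F.
have [cG cGE] := slice_surjective (fun n => trace F (Y n)).
have [r rE] := slice_surjective
  (fun k => match k with 0 => [set n | f (Y n) = false] | 1 => cF | _ => cG end).
exists r => Z JZ; have [m _ mZ] : range Y Z by rewrite -JY; left.
rewrite /independent_codes /= !rE cFE; split=> [[n fn]|fZ].
  by rewrite cGE -mZ => /sepF ->.
by exists m; rewrite /= ?cGE mZ.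
Qed.

(** * Singular and meager sets *)

Section Bases.
Variables (X : Type) (C : set (set X)).
Hypothesis baseC : category_base C.

Lemma singular_sub (S T : set X) : S `<=` T -> singular C T -> singular C S.
Proof.
move=> ST sT A /sT [B [rB BA BT]]; exists B; split=> //.
by rewrite -subset0 -BT; exact: setIS.
Qed.

Lemma singular0 : singular C set0.
Proof. by move=> A rA; exists A; rewrite setI0; split. Qed.

Lemma meager_cover (I : countType) (F : I -> set X) (S : set X) :
  (forall i, singular C (F i)) -> S `<=` \bigcup_i F i -> meager C S.
Proof.
move=> sF SF.
exists (fun n => if unpickle n is Some i then S `&` F i else set0); split=> [n|].
  by case: unpickle => [i|]; [apply: singular_sub (sF i) | exact: singular0].
apply/seteqP; split=> [x Sx|x [n _]]; last by case: unpickle => [i []|].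
by have [i _ Fx] := SF x Sx; exists (pickle i) => //; rewrite pickleK.
Qed.

Lemma singular_meager S : singular C S -> meager C S.
Proof. by move=> sS; apply: (@meager_cover unit (fun=> S)) => // x Sx; exists tt. Qed.

Lemma meager_sub (S T : set X) : S `<=` T -> meager C T -> meager C S.
Proof. by move=> ST [F [sF TF]]; apply: meager_cover sF _; rewrite -TF. Qed.

Lemma meager0 : meager C set0.
Proof. exact/singular_meager/singular0. Qed.

Lemma meager_bigcup (I : Type) (D : set I) (F : I -> set X) :
  countable D -> (forall i, D i -> meager C (F i)) -> meager C (\bigcup_(i in D) F i).
Proof.
move=> cD mF; have [->|] := eqVneq D set0; first by rewrite bigcup_set0; exact: meager0.
move=> /set0P /countable_range -/(_ cD) [u DE].
have /choice [G GP] n : exists G : nat -> set X,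
    (forall m, singular C (G m)) /\ F (u n) = \bigcup_m G m.
  by have [|G ?] := mF (u n); [rewrite DE; exists n | exists G].
apply: (@meager_cover (nat * nat)%type (fun k => G k.1 k.2)).
  by move=> [n m]; have [] := GP n.
move=> x [i]; rewrite {1}DE => -[n _ <-]; have [_ ->] := GP n.
by move=> [m _ Gx]; exists (n, m).
Qed.

Lemma meagerU (S T : set X) : meager C S -> meager C T -> meager C (S `|` T).
Proof.
move=> mS mT; have -> : S `|` T = \bigcup_(b : bool) (if b then S else T).
  apply/seteqP; split=> [x [?|?]|x [[] _ ?]]; [by exists true|by exists false|by left|by right].
by apply: meager_bigcup => // -[].
Qed.

Lemma countable_meager (S : set X) : point_meager C -> countable S -> meager C S.
Proof.
move=> pmC cS; rewrite (_ : S = \bigcup_(x in S) [set x]).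
  by apply: meager_bigcup.
by apply/seteqP; split=> [x Sx|x [y Sy ->]//]; exists x.
Qed.

(** * Consequences of the countable chain condition *)

Lemma region_exists : exists R, region C R.
Proof.
have [[x _] cov _ _] := baseC.
have [R CR Rx] : (\bigcup_(A in C) A) x by rewrite cov.
by exists R; split=> //; exists x.
Qed.

Hypothesis cccC : countable_chain_condition C.

(** When [C] is uncountable, take a maximal disjoint family of regions with
    property [P]: it is countable, hence of cardinality less than that of [C],
    and the second axiom shows that its union has a singular complement.  When
    [C] is countable that axiom says nothing about infinite families, but then
    one region chosen below each region already makes a countable family. *)
Lemma countable_predense (P : set X -> Prop) :
  (forall A, region C A -> exists B, [/\ region C B, B `<=` A & P B]) ->
  exists D : nat -> set X,
    (forall n, region C (D n) /\ P (D n)) /\ singular C (~` \bigcup_n D n).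
Proof.
move=> denseP; have [R0 rR0] := region_exists.
have [R [rR _ PR]] := denseP _ rR0.
have C0 : C !=set0 by exists R; case: rR.
have [cC|ncC] := pselect (countable C).
  have [|g gP] := @choice (set X) (set X)
      (fun A B => [/\ region C B, P B & region C A -> B `<=` A]).
    move=> A; have [rA|nrA] := pselect (region C A); last by exists R.
    by have [B [rB BA PB]] := denseP _ rA; exists B.
  have [u CE] := countable_range C0 cC.
  exists (g \o u); split=> [n|A rA]; first by have [] := gP (u n).
  have [n _ nA] : range u A by rewrite -CE; case: rA.
  have [rB _ /(_ rA) BA] := gP A; exists (g A); split=> //.
  apply/disjoints_subset; rewrite setCK => x gx; exists n => //=; by rewrite nA.
have [M [MP dM maxM]] := ex_maximal_disjoint_subcollection id
  [set B | region C B /\ P B].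
have dMr : disjoint_regions C M by split=> // B /MP [].
have cM := cccC dMr.
(* Maximality of [M], in the form in which it is used below. *)
have addM B : region C B -> P B -> (forall K, M K -> B `&` K = set0) -> False.
  move=> rB PB BM; have B0 : B !=set0 by case: rB.
  apply: (maxM (M `|` [set B])).
  - split=> [K MK|]; first by left.
    move=> /(_ B (or_intror erefl)) /BM; rewrite setIid => BE.
    by move: B0; rewrite BE => -[].
  - by move=> K [/MP//|->].
  - move=> K L [MK|->] [ML|->] // [x [Kx Lx]]; first by apply: dM => //; exists x.
      by have : (B `&` K) x by []; rewrite BM.
    by have : (B `&` L) x by []; rewrite BM.
have M0 : M !=set0.
  apply: contrapT => nM; apply: (addM _ rR PR) => K MK.
  by exfalso; apply: nM; exists K.
have ltM : card_lt M C.
  split; first by apply: subset_card_le => K /MP [[]].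
  by move=> CM; apply: ncC; exact: sub_countable CM cM.
have [u ME] := countable_range M0 cM.
have bigM : \bigcup_n u n = \bigcup_(K in M) K by rewrite ME bigcup_image.
exists u; split=> [n|A rA]; first by apply: MP; rewrite ME; exists n.
rewrite bigM.
have [[B rB BA]|nAM] := pselect (contains_region C (A `&` \bigcup_(K in M) K)).
  exists B; split=> // [x /BA []//|].
  by apply/disjoints_subset; rewrite setCK => x /BA [].
have [B [rB BA BM]] := category_base_avoid baseC rA M0 dMr ltM nAM.
have [B' [rB' B'B PB']] := denseP _ rB.
exfalso; apply: (addM _ rB' PB') => K /BM; rewrite -!subset0 => BK0.
by apply: subset_trans BK0; exact: setSI.
Qed.

(** Otherwise every region contains a subregion meeting [S] in a meager set, and
    [countable_predense] covers [S] by countably many such intersections and a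
    singular set. *)
Lemma abundant_Baire_region (S : set X) : abundant C S -> Baire_set C S ->
  exists2 R, region C R & meager C (R `\` S).
Proof.
move=> abS baS; apply: contrapT => noR; apply: abS.
have [A rA|D [DP sD]] := @countable_predense (fun R => meager C (R `&` S)).
  have [B [rB BA [mB|mB]]] := baS _ rA; first by exists B.
  by exfalso; apply: noR; exists B.
apply: (@meager_sub _ ((~` \bigcup_n D n) `|` \bigcup_n (D n `&` S))).
  move=> x Sx; have [[n _ Dx]|] := pselect ((\bigcup_n D n) x); last by left.
  by right; exists n.
apply: meagerU; first exact: singular_meager.
by apply: meager_bigcup => // n _; have [] := DP n.
Qed.

Lemma Baire_setI (S T : set X) :
  Baire_set C S -> Baire_set C T -> Baire_set C (S `&` T).
Proof.
move=> baS baT A /baS [B [rB BA [mB|mB]]].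
  by exists B; split=> //; left; apply: meager_sub mB => x [? []].
have [D [rD DB [mD|mD]]] := baT _ rB; exists D; split=> //.
- exact: subset_trans BA.
- by left; apply: meager_sub mD => x [? []].
- exact: subset_trans BA.
right; apply: meager_sub (meagerU mB mD) => x [Dx].
by rewrite setCI => -[nS|nT]; [left; split=> //; exact: DB | right].
Qed.

(** A singular set is contained in a singular complement of a countable union of
    regions, and a meager set in a countable union of such complements, so a
    doubly indexed sequence of regions, coded by one element of [set nat],
    determines a meager superset. *)
Lemma meager_cofinal_continuum : C #<= [set: set nat] ->
  exists N : set nat -> set X,
    (forall r, meager C (N r)) /\ forall M, meager C M -> exists r, M `<=` N r.
Proof.
move=> cardC; have [R0 [CR0 _]] := region_exists.
have [c CE] := card_le_range (ex_intro _ R0 CR0) cardC.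
pose K r := \bigcup_n ~` \bigcup_m c (slice (slice r n) m).
(* Codes for which [K r] is not meager are sent to the empty set. *)
exists (fun r => if `[< meager C (K r) >] then K r else set0); split=> [r|M].
  by case: asboolP => // _; exact: meager0.
move=> [F [sF ->]].
have /choice [D DP] n : exists D : nat -> set nat,
    singular C (~` \bigcup_m c (D m)) /\ F n `<=` ~` \bigcup_m c (D m).
  have [A rA|D [DP sD]] := @countable_predense (fun R => R `&` F n = set0).
    by have [B [rB BA BF]] := sF n _ rA; exists B.
  have /choice [d dE] m : exists t, c t = D m.
    by have : C (D m) by [have [[]] := DP m]; rewrite CE => -[t _ <-]; exists t.
  exists d; rewrite (eq_bigcupr (fun m _ => dE m)); split=> //.
  move=> x Fx [m _ Dx]; have [_ D0] := DP m.
  by have : (D m `&` F n) x by []; rewrite D0.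
have [s sE] := choice (fun n => slice_surjective (D n)).
have [r rE] := slice_surjective s.
exists r; have KE : K r = \bigcup_n ~` \bigcup_m c (D n m).
  by apply: eq_bigcupr => // n _; rewrite rE; congr (~` _); apply: eq_bigcupr => // m _; rewrite sE.
case: asboolP => [_|[]]; rewrite KE.
  by apply: subset_bigcup => n _; have [] := DP n.
by apply: meager_bigcup => // n _; apply: singular_meager; have [] := DP n.
Qed.

End Bases.

(** * Luzin sets *)

Lemma rare_sub (X : Type) (C : set (set X)) (S T : set X) :
  S `<=` T -> rare C T -> rare C S.
Proof.
by move=> ST rT M mM; apply: sub_countable (rT M mM); apply: subset_card_le; exact: setSI.
Qed.

Lemma meager_bijection (X : Type) (C : set (set X)) (Phi : set (X -> X)) phi (S : set X) :
  bijection_group Phi -> family_invariant Phi C -> Phi phi ->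
  meager C S -> meager C (phi @` S).
Proof.
move=> gP inv Pphi [F [sF ->]]; have [psi phiK psiK] := bijection_group_bij gP Pphi.
have Ppsi := bijection_group_inv gP Pphi phiK psiK.
have regI chi R : Phi chi -> region C R -> region C (chi @` R).
  move=> Pchi [CR R0]; split; last exact/image_nonempty.
  by rewrite -(inv _ Pchi); exists R.
exists (fun n => phi @` F n); split=> [n A rA|]; last by rewrite image_bigcup.
have [B [rB BA BF]] := sF n _ (regI _ _ Ppsi rA).
exists (phi @` B); split; first exact: regI.
  by move=> _ [x /BA [y Ay <-] <-]; rewrite psiK.
rewrite -subset0 => _ [[x Bx <-] [y Fy /(can_inj phiK) yx]].
have : (B `&` F n) x by split=> //; rewrite -yx.
by rewrite BF.
Qed.

Lemma rare_bijection (X : Type) (C : set (set X)) (Phi : set (X -> X)) phi (S : set X) :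
  bijection_group Phi -> family_invariant Phi C -> Phi phi ->
  rare C S -> rare C (phi @` S).
Proof.
move=> gP inv Pphi rS M mM; have [psi phiK psiK] := bijection_group_bij gP Pphi.
have Ppsi := bijection_group_inv gP Pphi phiK psiK.
have := countable_image phi (rS _ (meager_bijection gP inv Ppsi mM)).
apply: sub_countable; apply: subset_card_le => _ [[x Sx <-] Mx].
by exists x => //; split=> //; exists (phi x) => //; rewrite phiK.
Qed.

(** A Luzin set inside [E], enumerated so that each label [r] is carried by
    uncountably many of its points in each region almost contained in [E],
    whatever meager set is discarded.  Stage [a] of the recursion picks its
    point in the region coded by [slice a 1]. *)
Lemma Luzin_enumeration (X : Type) (C : set (set X)) (E : set X) :
  continuum_hypothesis -> category_base C -> point_meager C -> Baire_base C ->
  countable_chain_condition C -> C #<= [set: set nat] ->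
  abundant C E -> Baire_set C E ->
  exists x : set nat -> X,
    [/\ injective x, forall a, E (x a), rare C (range x)
      & forall r R M, region C R -> meager C (R `\` E) -> meager C M ->
          ~ countable [set a | slice a 0 = r /\ (R `\` M) (x a)]].
Proof.
move=> CH baseC pmC BaireC cccC cardC abE BaireE.
have [lt [wf tot segc]] := omega1_well_order CH.
have [N [mN cofN]] := meager_cofinal_continuum baseC cccC cardC.
pose G := [set R | region C R /\ meager C (R `\` E)].
have G0 : G !=set0.
  by have [R rR mR] := abundant_Baire_region baseC cccC abE BaireE; exists R.
have [|c GE] := card_le_range G0 _ (B := [set: set nat]).
  by apply: card_le_trans cardC; apply: subset_card_le => R [[]].
pose T a := (c (slice a 1) `&` E) `\` \bigcup_(b in [set b | ~ lt a b]) N b.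
(* The indices [b] with [~ lt a b] are the countably many ones up to [a]. *)
have segc' a : countable [set b | ~ lt a b].
  apply: sub_countable (countableU (segc a) (countable1 a)).
  apply: subset_card_le => b /= nab.
  by have [//|->|] := tot a b; [right|left].
have [a D cD|x [xinj xT]] := transfinite_injective_choice (T := T) wf tot segc.
  have [rR mR] : G (c (slice a 1)) by rewrite GE; exists (slice a 1).
  apply: contrapT => TD0; apply: (BaireC _ rR).
  have mD := countable_meager pmC cD.
  have mS : meager C (\bigcup_(b in [set b | ~ lt a b]) N b) by apply: meager_bigcup.
  apply: meager_sub (meagerU mR (meagerU mS mD)) => y Ry.
  have [Ey|nEy] := pselect (E y); last by left.
  right; apply: contrapT => /not_orP [nS nD]; apply: TD0; exists y.
  by split.
have late a b : N b (x a) -> lt a b.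
  move=> Nx; apply: contrapT => nab; have [_] := xT a; apply.
  by exists b.
exists x; split=> // [a|M mM|r R M rR mR mM cK].
- by have [[]] := xT a.
- have [b Mb] := cofN M mM.
  apply: sub_countable (countable_image x (segc b)).
  by apply: subset_card_le => _ [[a _ <-] /Mb/late ab]; exists a.
have [s _ cs] : range c R by rewrite -GE.
have [b Mb] := cofN M mM.
have [ncW _] := CH; apply: ncW.
(* Slice 0 carries the label, slice 1 the region, and slice 2 is free: its
   continuum many values make the stages with given label and region
   uncountable in number. *)
have [p pE] := choice (fun t => slice_surjective
  (fun k => match k with 0 => r | 1 => s | _ => t end)).
have pinj : injective p by move=> t u /(congr1 (slice ^~ 2)); rewrite /= !pE.
rewrite -(eq_countable (inj_card_eq (in2W pinj))).
apply: sub_countable (countableU cK (segc b)); apply: subset_card_le.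
move=> _ [t _ <-]; have [Nx|nNx] := pselect (N b (x (p t))).
  by right; exact: late.
left; rewrite /= pE; split=> //; have [[Rx _] _] := xT (p t).
by split; [move: Rx; rewrite pE cs | move=> /Mb].
Qed.

(** * The independent family *)

Theorem theorem2p6 (CH : continuum_hypothesis)
    (X : Type) (C : set (set X)) (Phi : set (X -> X))
    (baseC : category_base C)
    (pmC : point_meager C)
    (BaireC : Baire_base C)
    (cccC : countable_chain_condition C)
    (groupPhi : bijection_group Phi)
    (cardPhi : Phi #<= [set: set nat])
    (invC : family_invariant Phi C)
    (cardC : C #<= [set: set nat])
    (transPhi : forall A D : set X, region C A -> region C D ->
       exists2 phi, Phi phi & contains_region C (A `&` phi @` D))
    (E : set X) (abE : abundant C E) (BaireE : Baire_set C E)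
    (invE : forall phi, Phi phi -> phi @` E = E) :
  exists (I : Type) (A : I -> set X),
    [/\ forall i, A i `<=` E,
        has_card_two_pow_aleph1 (range A),
        forall i, rare C (A i) /\ ~ Baire_set C (A i),
        forall i phi, Phi phi -> rare C (phi @` A i)
      & strictly_aleph0_independent C E A /\ aleph0_independent C E A].
Proof.
have [x [xinj xE rareL bigL]] :=
  Luzin_enumeration CH baseC pmC BaireC cccC cardC abE BaireE.
(* Slice 0 of an index is the label of the corresponding point. *)
pose A Y := x @` [set a | independent_codes Y (slice a 0)].
have AE Y : A Y `<=` E by move=> _ [a _ <-].
have AxP Y a : A Y (x a) <-> independent_codes Y (slice a 0).
  by split=> [[b bY /xinj <-]//|aY]; exists a.
have rareA Y : rare C (A Y) by apply: rare_sub rareL => _ [a _ <-]; exists a.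
have indepA : strictly_aleph0_independent C E A.
  move=> J f cJ; split=> [y []//|B abB baB abBE mBS].
  have [r rP] := independent_codesP f cJ.
  have [R rR mR] := abundant_Baire_region baseC cccC abBE (Baire_setI baB BaireE).
  apply: (bigL r R _ rR _ mR).
    by apply: meager_sub mR => y [Ry nEy]; split=> // -[].
  have := rareL _ mBS.
  rewrite -(eq_countable (inj_card_eq (in2W xinj))).
  apply: sub_countable; apply: subset_card_le => _ [a [ar [Rx nx]] <-].
  (* The discarded meager set is [R] minus [B `&` E], so [x a] lies in [B]. *)
  have [Bx _] : (B `&` E) (x a) by apply: contrapT => nBE; apply: nx.
  split; first by exists a.
  split=> //; split=> [|Y JY]; first exact: xE.
  rewrite /signed; have := rP Y JY; rewrite -ar -AxP.
  case: (f Y) => -[h1 h2]; last exact: h2.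
  by split=> [|/h1]; first exact: xE.
have splitA Y Z : Y <> Z -> (A Y `\` A Z) !=set0.
  move=> YZ; apply: contrapT => n0.
  have [_ full] := indepA [set Y; Z] (fun U => `[< U <> Y >])
    (countableU (countable1 Y) (countable1 Z)).
  have /= := full E abE BaireE; rewrite setIid => /(_ abE); apply.
  apply: meager_sub (meager0 C) => y [_ [_ yYZ]]; apply: n0; exists y; split.
    by have := yYZ Y (or_introl erefl); rewrite /signed; case: asboolP => // /(_ erefl).
  have := yYZ Z (or_intror erefl); rewrite /signed; case: asboolP => [_ []//|].
  by move=> /contrapT ZY; case: YZ.
have abA Y : abundant C (A Y).
  have [_ full] := indepA [set Y] (fun=> false) (countable1 _).
  have := full E abE BaireE; rewrite setIid => /(_ abE).
  by apply: contra_not; apply: meager_sub => y [Ey [_ /(_ Y erefl)]].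
exists (set (set nat)), A; split=> //.
- exists (set nat); split=> //; apply: inj_card_eq => Y Z _ _ AYZ.
  apply: contrapT => /splitA [y []]; by rewrite AYZ.
- move=> Y; split=> // baAY.
  have [_ full] := indepA [set Y] (fun=> true) (countable1 _).
  apply: (full _ (abA Y) baAY).
    by rewrite (setIidl (AE Y)).
  apply: meager_sub (meager0 C) => y [Ay [_ /(_ Y erefl)]].
  by move=> [].
- move=> Y phi Pphi; exact: (rare_bijection groupPhi invC Pphi (rareA Y)).
- by split=> // J f /finite_set_countable; exact: indepA.
Qed.
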